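(* Let $\widehat{A}=A+\varepsilon B$ be an $n\times n$ dual matrix with $A,B\in\mathbb{R}^{n\times n}$. If $\mathrm{Ind}(A)=1$, the dual Moore–Penrose generalized inverse $\widehat{A}^{+}$ exists, and $\widehat{A}^{+}=A^{+}-\varepsilon A^{+}BA^{+}$, then the dual core generalized inverse $\widehat{A}^{\mathrm{c}}$ exists and $\widehat{A}^{\mathrm{c}}=A^{\mathrm{c}}-\varepsilon A^{\mathrm{c}}BA^{\mathrm{c}}$.
   Context: Dual numbers are $a+\varepsilon a'$ with $a,a'\in\mathbb{R}$ and $\varepsilon\neq 0$, $\varepsilon^2=0$ (i.e. the ring $\mathbb{R}[\varepsilon]/(\varepsilon^2)$). A dual matrix is a matrix over dual numbers, written $\widehat{A}=A+\varepsilon B$ with $A,B$ real; its transpose is $\widehat{A}^{T}=A^{T}+\varepsilon B^{T}$. For an $n\times n$ dual matrix $\widehat{A}$ (each inverse below is unique when it exists): the dual Moore–Penrose generalized inverse (DMPGI) $\widehat{A}^{+}$ is the $\widehat{X}$ with $\widehat{A}\widehat{X}\widehat{A}=\widehat{A}$, $\widehat{X}\widehat{A}\widehat{X}=\widehat{X}$, $(\widehat{A}\widehat{X})^{T}=\widehat{A}\widehat{X}$, $(\widehat{X}\widehat{A})^{T}=\widehat{X}\widehat{A}$; the dual core generalized inverse (DCGI) $\widehat{A}^{\mathrm{c}}$ is the $\widehat{G}$ with $\widehat{A}\widehat{G}\widehat{A}=\widehat{A}$, $\widehat{A}\widehat{G}^2=\widehat{G}$, $(\widehat{A}\widehat{G})^{T}=\widehat{A}\widehat{G}$.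 For a real square matrix $A$, $A^{+}$ is its Moore–Penrose inverse, ''$\mathrm{Ind}(A)=1$'' means $\mathrm{rank}(A^2)=\mathrm{rank}(A)$, and in that case the core inverse $A^{\mathrm{c}}$ is the unique real $X$ with $AXA=A$, $AX^2=X$, $(AX)^{T}=AX$. *)

(* Defs.v *)
From mathcomp Require Import all_boot all_order all_algebra.
From mathcomp Require Import qpoly.
From mathcomp Require Import boolp classical_sets reals.

Set Implicit Arguments.
Unset Strict Implicit.
Unset Printing Implicit Defensive.

Import Order.TTheory GRing.Theory Num.Theory.
Local Open Scope ring_scope.
Local Open Scope classical_set_scope.

(* R[X]/(X^2); its elements are the polynomials of size at most 2, with the two
   parts of a dual number as coefficients of 1 and X. *)
Notation dual R := {poly %/ ('X^2 : {poly R})}.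

Section DualTheory.
Variable R : comNzRingType.

Definition eps : dual R := in_qpoly 'X^2 'X.

Definition dual_real (a : R) : dual R := qpolyC 'X^2 a.

Definition real_mx m n (A : 'M[R]_(m, n)) : 'M[dual R]_(m, n) :=
  map_mx dual_real A.

Lemma eps_sqr : eps * eps = 0.
Proof.
rewrite /eps -[LHS](in_qpolyM 'X^2 'X 'X) -expr2; apply: val_inj => /=.
by rewrite mk_monic_Xn Pdiv.RingMonic.rmodpp ?monicXn.
Qed.

Lemma val_eps : val eps = 'X :> {poly R}.
Proof. by rewrite /eps [LHS]qpolyXE ?size_polyXn ?monicXn. Qed.

Lemma eps_neq0 : eps != 0.
Proof.
by apply/eqP => /(congr1 val); rewrite val_eps => /eqP; rewrite polyX_eq0.
Qed.

End DualTheory.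

Arguments eps {R}.

Section Inverses.
Variables (R : comNzRingType) (n : nat).
Implicit Types A X : 'M[R]_n.

Definition is_mpinv A X : Prop :=
  [/\ A *m X *m A = A,
      X *m A *m X = X,
      (A *m X)^T = A *m X
    & (X *m A)^T = X *m A].

Definition is_coreinv A X : Prop :=
  [/\ A *m X *m A = A,
      A *m (X *m X) = X
    & (A *m X)^T = A *m X].

(* Both are used with coefficients in the reals and in the dual numbers.  When
   no inverse exists they return 0, which carries no information. *)
Definition mpinv A : 'M[R]_n := xget 0 [set X | is_mpinv A X].

Definition coreinv A : 'M[R]_n := xget 0 [set X | is_coreinv A X].

End Inverses.

(* rank(A^2) = rank(A): so invertible matrices are included. *)
Definition index_one (F : fieldType) n (A : 'M[F]_n) : Prop :=
  \rank (A *m A) = \rank A.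

(* Main.v *)
Require Import Defs.
From mathcomp Require Import all_boot all_order all_algebra reals.
From mathcomp Require Import qpoly classical_sets.

(** Let [P] be the real part of the dual Moore-Penrose inverse [P - eps PBP].
    The infinitesimal part of the symmetry of [hatA *m X] says that
    [M = (1 - AP)BP] is symmetric.  As [AP] is a symmetric idempotent that
    kills [M] on the left, it also kills it on the right, whence [MA = 0], and
    the first Penrose equation then gives [APB = B].  Since [Ind(A) = 1], the
    core inverse [C] of [A] exists and satisfies [AC = AP].  Hence [ACB = B],
    so the product of [hatA] with [C - eps CBC] is the real projector [AC],
    from which the core equations are immediate. *)

Set Implicit Arguments.
Unset Strict Implicit.
Unset Printing Implicit Defensive.

Import GRing.Theory.
Local Open Scope ring_scope.

Section DualMatrices.
Variable R : comNzRingType.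

Definition dual_mx m n (A B : 'M[R]_(m, n)) : 'M[dual R]_(m, n) :=
  real_mx A + eps *: real_mx B.

(** Makes [eps * dual_real b] the scalar multiple [b *: eps], whose coefficients can be read off. *)
Lemma dual_realE (a : R) : dual_real a = a *: 1.
Proof. by apply: val_inj; rewrite /= alg_polyC. Qed.

Lemma dual_coef (a b : R) (i : nat) :
  (val (dual_real a + eps * dual_real b))`_i =
  if i is i'.+1 then (if i' is 0 then b else 0) else a.
Proof.
rewrite !dual_realE -scalerAr mulr1.
have -> : val (a *: 1 + b *: eps : dual R) = a *: 1 + b *: 'X.
  by rewrite /= -[X in _ = _ + b *: X](@val_eps R).
rewrite coefD !coefZ coef1 coefX.
by case: i => [|[|i]] /=; rewrite ?(mulr1, mulr0, addr0, add0r).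
Qed.

(** Serves to split a dual equation into its real and infinitesimal parts. *)
Lemma dual_mx_inj m n (A B A' B' : 'M[R]_(m, n)) :
  dual_mx A B = dual_mx A' B' -> A = A' /\ B = B'.
Proof.
move=> E; split; apply/matrixP => i j.
  have /(congr1 (fun M : 'M[dual R]_(m, n) => (val (M i j))`_0)) := E.
  by rewrite !mxE !dual_coef.
have /(congr1 (fun M : 'M[dual R]_(m, n) => (val (M i j))`_1)) := E.
by rewrite !mxE !dual_coef.
Qed.

Lemma real_mxM m n p (A : 'M[R]_(m, n)) (B : 'M[R]_(n, p)) :
  real_mx (A *m B) = real_mx A *m real_mx B.
Proof. exact: (map_mxM (qpolyC 'X^2)). Qed.

Lemma real_mxD m n (A B : 'M[R]_(m, n)) :
  real_mx (A + B) = real_mx A + real_mx B.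
Proof. exact: (map_mxD (qpolyC 'X^2)). Qed.

Lemma real_mxN m n (A : 'M[R]_(m, n)) : real_mx (- A) = - real_mx A.
Proof. exact: (map_mxN (qpolyC 'X^2)). Qed.

Lemma dual_mulmx m n p (A B : 'M[R]_(m, n)) (C D : 'M[R]_(n, p)) :
  dual_mx A B *m dual_mx C D = dual_mx (A *m C) (A *m D + B *m C).
Proof.
rewrite /dual_mx mulmxDl !mulmxDr real_mxD !real_mxM scalerDr.
rewrite -!scalemxAl -!scalemxAr scalerA eps_sqr scale0r addr0.
by rewrite addrA.
Qed.

Lemma dual_mx_tr m n (A B : 'M[R]_(m, n)) :
  (dual_mx A B)^T = dual_mx A^T B^T.
Proof. by rewrite /dual_mx linearD linearZ /= /real_mx !map_trmx. Qed.

Lemma dual_mxNE m n (A B : 'M[R]_(m, n)) :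
  real_mx A - eps *: real_mx B = dual_mx A (- B).
Proof. by rewrite /dual_mx real_mxN scalerN. Qed.

End DualMatrices.

Section CoreInverse.
Variables (R : comNzRingType) (n : nat).
Implicit Types A X Y : 'M[R]_n.

(* [E = AX] is idempotent with [EA = A] and [EX = X], so [AE + (1 - E)] has
   right inverse [XE + (1 - E)], which is two-sided for square matrices. *)
Lemma coreinv_mulKmx A X : is_coreinv A X -> X *m A *m A = A.
Proof.
case=> AXA AXX _; have [E defE] : exists E, A *m X = E by exists (A *m X).
have EA : E *m A = A by rewrite -defE.
have EX : E *m X = X by rewrite -defE -mulmxA.
have EE : E *m E = E by rewrite -{2}defE mulmxA EA.
have [F defF] : exists F, 1%:M - E = F by exists (1%:M - E).
have FA : F *m A = 0 by rewrite -defF mulmxBl mul1mx EA subrr.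
have FX : F *m X = 0 by rewrite -defF mulmxBl mul1mx EX subrr.
have EF : E *m F = 0 by rewrite -defF mulmxBr mulmx1 EE subrr.
have FF : F *m F = F by rewrite -{1}defF mulmxBl mul1mx EF subr0.
have /mulmx1C : (A *m E + F) *m (X *m E + F) = 1%:M.
  rewrite mulmxDl !mulmxDr -!mulmxA EF (mulmxA E) EX mulmxA defE EE.
  by rewrite mulmxA FX FF mulmx0 mul0mx addr0 add0r -defF addrC subrK.
(* The swapped product expands to [XAE + F = 1], so [XAE = 1 - F = E]; then multiply by [A] on the
   right. *)
rewrite mulmxDl !mulmxDr -!mulmxA EF (mulmxA E) EA (mulmxA F) FA FF.
rewrite mulmx0 mul0mx addr0 add0r => /(canRL (addrK F)).
rewrite -defF opprB addrC subrK => XAE.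
by have := congr1 (mulmx^~ A) XAE; rewrite -!mulmxA EA mulmxA.
Qed.

(* Both sides are the orthogonal projector on the range of [A]. *)
Lemma mulmx_sym_inner A X Y :
  A *m X *m A = A -> (A *m X)^T = A *m X ->
  A *m Y *m A = A -> (A *m Y)^T = A *m Y -> A *m X = A *m Y.
Proof.
move=> AXA sX AYA sY.
have XY : A *m X *m (A *m Y) = A *m Y by rewrite mulmxA AXA.
by rewrite -sY -XY trmx_mul sX sY mulmxA AYA.
Qed.

(** [XAA = A] and [AXX = X] give [XAX = X]. As [AX = AY], it follows that
    [X = XAY = XAAYY = AYY = Y]. *)
Lemma coreinv_uniq A X Y : is_coreinv A X -> is_coreinv A Y -> X = Y.
Proof.
move=> cX cY; have [AXA AXX sX] := cX; have [AYA AYY sY] := cY.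
have AXY : A *m X = A *m Y by apply: mulmx_sym_inner.
have <- : X *m (A *m X) = X.
  by rewrite -{2}AXX !mulmxA (coreinv_mulKmx cX) -mulmxA.
by rewrite AXY -{1}AYY !mulmxA (coreinv_mulKmx cX) -mulmxA.
Qed.

Lemma coreinvE A X : is_coreinv A X -> coreinv A = X.
Proof.
move=> cX; apply: (@coreinv_uniq A) => //.
exact: (xgetI (P := is_coreinv A) 0 cX).
Qed.

End CoreInverse.

Lemma index_one_coreinv (F : fieldType) (n : nat) (A P : 'M[F]_n) :
  index_one A -> A *m P *m A = A -> (A *m P)^T = A *m P ->
  is_coreinv A (coreinv A).
Proof.
move=> indA APA sP.
(* Equal ranks make the column spaces of [A] and [AA] coincide; transposes turn columns into
   rows. *)
have /submxP[W AW] : (A^T <= A^T *m A^T)%MS.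
  rewrite -(geq_leqif (mxrank_leqif_sup (submxMl _ _))).
  by rewrite -trmx_mul !mxrank_tr indA.
have AAZ : A *m A *m W^T = A by rewrite -[RHS]trmxK AW !trmx_mul !trmxK.
have AC : A *m (A *m W^T *m P) = A *m P by rewrite !mulmxA AAZ.
(* The witness is [C = AZP] with [Z = W^T]: [AC = AP] by [AAZ = A], then [ACC = APAZP = AZP = C]. *)
apply: (xgetPex (P := is_coreinv A) 0); exists (A *m W^T *m P); split.
- by rewrite AC.
- by rewrite mulmxA AC !mulmxA APA.
- by rewrite AC.
Qed.

Section DualInverses.
Variables (R : comNzRingType) (n : nat).
Implicit Types A B C P : 'M[R]_n.

Lemma dual_mpinv_real A B P :
  is_mpinv (dual_mx A B) (dual_mx P (- (P *m B *m P))) ->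
  [/\ A *m P *m A = A, (A *m P)^T = A *m P & A *m P *m B = B].
Proof.
case=> + _ + _; rewrite !dual_mulmx dual_mx_tr => EA /dual_mx_inj[sAP sM].
have [APA EB] := dual_mx_inj EA; split=> //.
move: sM EB; set M := A *m _ + B *m P => sM EB.
have ME : M = B *m P - A *m P *m B *m P by rewrite /M mulmxN !mulmxA addrC.
have AP0 : A *m P *m M = 0 by rewrite ME mulmxBr !mulmxA APA subrr.
have MAP0 : M *m (A *m P) = 0 by rewrite -sM -sAP -trmx_mul AP0 trmx0.
(* [EB] reads [APB + MA = B], and [MA = M(AP)A = 0]. *)
by rewrite -{2}APA mulmxA MAP0 mul0mx addr0 in EB.
Qed.

Lemma dual_coreinv A B C :
  is_coreinv A C -> A *m C *m B = B ->
  is_coreinv (dual_mx A B) (dual_mx C (- (C *m B *m C))).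
Proof.
case=> ACA ACC sAC ACB.
have AG : dual_mx A B *m dual_mx C (- (C *m B *m C)) = dual_mx (A *m C) 0.
  by rewrite dual_mulmx mulmxN !mulmxA ACB addNr.
split; rewrite ?mulmxA AG ?dual_mulmx ?dual_mx_tr.
- by rewrite ACA ACB mul0mx addr0.
- by rewrite mulmxN mul0mx addr0 !mulmxA -[A *m C *m C]mulmxA ACC.
- by rewrite sAC trmx0.
Qed.

End DualInverses.

Theorem theorem3p13 (R : realType) (n : nat) (A B : 'M[R]_n)
    (hatA : 'M[dual R]_n)
    (hatA_def : hatA = real_mx A + eps *: real_mx B)
    (indA : index_one A)
    (mp_exists : exists X : 'M[dual R]_n, is_mpinv hatA X)
    (mp_formula : mpinv hatA
       = real_mx (mpinv A) - eps *: real_mx (mpinv A *m B *m mpinv A)) :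
  (exists G : 'M[dual R]_n, is_coreinv hatA G) /\
  coreinv hatA
    = real_mx (coreinv A) - eps *: real_mx (coreinv A *m B *m coreinv A).
Proof.
(* By [mp_exists], [mpinv hatA] is a genuine inverse, not the default 0. *)
have : is_mpinv hatA (mpinv hatA) by apply: (xgetPex (P := is_mpinv hatA) 0).
rewrite mp_formula hatA_def !dual_mxNE -/(dual_mx A B).
(* The properties of [mpinv A] are read off the real parts of the dual equations. *)
case/dual_mpinv_real=> APA sAP APB.
have cA := index_one_coreinv indA APA sAP; have [ACA _ sAC] := cA.
have ACB : A *m coreinv A *m B = B.
  by rewrite (@mulmx_sym_inner _ _ A _ (mpinv A)).
have cG := dual_coreinv cA ACB.
by split; [eexists; exact: cG | exact: coreinvE].
Qed.
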